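(* Let $A\in\mathbb{R}^{n\times n}$ be symmetric positive definite, let $S\in\mathbb{R}^{n\times n_{\rm s}}$ ($n_{\rm s}\leq n$) and $P\in\mathbb{R}^{n\times n_{\rm c}}$ ($n_{\rm c}<n$) be of full column rank with $\operatorname{rank}(S\ \, P)=n$ (and $S=I_n$ if $n_{\rm s}=n$), put $A_{\rm s}=S^{T}AS$, and let $M_{\rm s}\in\mathbb{R}^{n_{\rm s}\times n_{\rm s}}$ be a nonsingular matrix such that $M_{\rm s}+M_{\rm s}^{T}-A_{\rm s}$ is positive definite. Let $A_{\rm c}=P^{T}AP$, $\Pi_{A}=PA_{\rm c}^{-1}P^{T}A$, $\widetilde{M}_{\rm s}=M_{\rm s}^{T}\big(M_{\rm s}+M_{\rm s}^{T}-A_{\rm s}\big)^{-1}M_{\rm s}$, and let $$E_{\rm TL}=\big(I-SM_{\rm s}^{-T}S^{T}A\big)(I-\Pi_{A})\big(I-SM_{\rm s}^{-1}S^{T}A\big)$$ be the iteration matrix of the two-level method. Then $$\|E_{\rm TL}\|_{A}=1-\lambda_{n_{\rm s}+n_{\rm c}-n+1}\big(\widetilde{M}_{\rm s}^{-1}S^{T}A(I-\Pi_{A})S\big).$$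
   Context: $(S\ \, P)$ denotes the $n\times(n_{\rm s}+n_{\rm c})$ matrix formed by the columns of $S$ followed by those of $P$. For a matrix with real spectrum (as is the case here), $\lambda_{i}(\cdot)$ denotes the $i$th smallest eigenvalue, counted with multiplicity. For the symmetric positive definite matrix $A$, $\|\mathbf{v}\|_{A}=\sqrt{\mathbf{v}^{T}A\mathbf{v}}$ for $\mathbf{v}\in\mathbb{R}^{n}$, and $\|B\|_{A}=\max_{\mathbf{v}\neq 0}\|B\mathbf{v}\|_{A}/\|\mathbf{v}\|_{A}$ for $B\in\mathbb{R}^{n\times n}$. The quantity $\|E_{\rm TL}\|_A$ is called the convergence factor of the two-level method: the method performs one presmoothing step $\mathbf{u}\leftarrow\mathbf{u}+SM_{\rm s}^{-1}S^{T}(\mathbf{f}-A\mathbf{u})$, one coarse-level correction $\mathbf{u}\leftarrow\mathbf{u}+PA_{\rm c}^{-1}P^{T}(\mathbf{f}-A\mathbf{u})$ and one postsmoothing step $\mathbf{u}\leftarrow\mathbf{u}+SM_{\rm s}^{-T}S^{T}(\mathbf{f}-A\mathbf{u})$ for the system $A\mathbf{u}=\mathbf{f}$. *)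

(* Defs.v *)
From HB Require Import structures.
From mathcomp Require Import all_boot all_order all_algebra.
From mathcomp Require Import polyrcf.
From mathcomp Require Import all_classical all_reals all_analysis.

Set Implicit Arguments.
Unset Strict Implicit.
Unset Printing Implicit Defensive.

Import Order.TTheory GRing.Theory Num.Theory.
Import numFieldNormedType.Exports.
Local Open Scope classical_set_scope.
Local Open Scope ring_scope.

Section Spectrum.
Variable R : realType.

(* Eigenvalues are repeated according to their multiplicity as roots of the
   characteristic polynomial; [rootsR] is strictly increasing, so the list is
   sorted.  Non-real eigenvalues are not listed: see [real_spectrumP]. *)
Definition real_spectrum (m : nat) (B : 'M[R]_m) : seq R :=
  flatten [seq nseq (mup x (char_poly B)) x | x <- rootsR (char_poly B)].

(* 1-based index: [eigval B 1] is the smallest eigenvalue. *)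
Definition eigval (m : nat) (B : 'M[R]_m) (i : nat) : R :=
  nth 0 (real_spectrum B) i.-1.

Lemma count_real_spectrum (m : nat) (B : 'M[R]_m) (x : R) :
  count_mem x (real_spectrum B) = mup x (char_poly B).
Proof.
have p0 : char_poly B != 0 by exact/monic_neq0/char_poly_monic.
rewrite /real_spectrum count_flatten -map_comp.
have -> : sumn [seq (count_mem x \o
     (fun y => nseq (mup y (char_poly B)) y)) y | y <- rootsR (char_poly B)] =
    (\sum_(y <- rootsR (char_poly B) | y == x) mup y (char_poly B))%N.
  rewrite sumnE big_map [RHS]big_mkcond; apply: eq_bigr => y _ /=.
  by rewrite count_nseq /=; case: eqVneq; rewrite ?mul1n ?mul0n.
have uniq_roots : uniq (rootsR (char_poly B)).
  by apply: (@sorted_uniq _ <%R); [exact: lt_trans|exact: ltxx|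
    exact: sorted_roots].
have [xr|xNr] := boolP (x \in rootsR (char_poly B)).
  by rewrite -big_filter filter_pred1_uniq// big_seq1.
rewrite big1_seq => [|y /andP[/eqP -> yr]]; last by rewrite yr in xNr.
rewrite mupNroot//; apply: contra xNr => rx.
by rewrite -(roots_on_rootsR p0) in_itv/= rx.
Qed.

Lemma sorted_real_spectrum (m : nat) (B : 'M[R]_m) :
  sorted <=%R (real_spectrum B).
Proof.
rewrite /real_spectrum.
have : sorted <%R (rootsR (char_poly B)) by exact: sorted_roots.
rewrite (sorted_pairwise le_trans) (sorted_pairwise lt_trans).
elim: (rootsR _) => //= x s IH /andP[/allP xs /IH {}IH].
rewrite pairwise_cat IH andbT; apply/andP; split.
  apply/allrelP => y z; rewrite mem_nseq => /andP[_ /eqP ->].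
  move=> /flatten_mapP[t ts]; rewrite mem_nseq => /andP[_ /eqP ->].
  exact/ltW/xs.
elim: (mup _ _) => //= k ->; rewrite andbT.
by apply/allP => y; rewrite mem_nseq => /andP[_ /eqP ->].
Qed.

Lemma real_spectrumP (m : nat) (B : 'M[R]_m) (s : seq R) :
  sorted <=%R s -> char_poly B = \prod_(x <- s) ('X - x%:P) ->
  real_spectrum B = s.
Proof.
move=> ss Bs; apply: (sorted_eq le_trans le_anti) => //.
  exact: sorted_real_spectrum.
by apply/allP => x _; rewrite /= count_real_spectrum Bs mu_prod_XsubC.
Qed.

End Spectrum.

Section EnergyNorm.
Variable R : realType.

Definition pos_def (m : nat) (C : 'M[R]_m) : Prop :=
  forall v : 'cV[R]_m, v != 0 -> 0 < (v^T *m C *m v) 0 0.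

Definition spd (m : nat) (C : 'M[R]_m) : Prop := C^T = C /\ pos_def C.

Definition energy_norm (m : nat) (A : 'M[R]_m) (v : 'cV[R]_m) : R :=
  Num.sqrt ((v^T *m A *m v) 0 0).

Definition is_maximum (X : set R) (c : R) : Prop := X c /\ ubound X c.

(* The maximum exists whenever [A] is positive definite and [0 < m]: see
   [energy_norm_mxP]. *)
Definition energy_norm_mx (m : nat) (A B : 'M[R]_m) : R :=
  xget 0 [set c | is_maximum
    [set energy_norm A (B *m v) / energy_norm A v | v in [set v | v != 0]] c].

Lemma quad_continuous (m : nat) (C : 'M[R]_m) :
  continuous (fun u : 'rV[R]_m => (u *m C *m u^T) 0 0).
Proof.
have -> : (fun u : 'rV[R]_m => (u *m C *m u^T) 0 0) =
    (fun u : 'rV[R]_m => \sum_j (\sum_i u 0 i * C i j) * u 0 j).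
  by apply/funext => u; rewrite mxE; apply: eq_bigr => j _; rewrite !mxE.
pose addc := @add_continuous R.
move=> u; apply: (cvg_big addc (nbhs_filter u)) => j _.
apply: (@cvgM R _ (nbhs u)); last exact: coord_continuous.
apply: (cvg_big addc (nbhs_filter u)) => i _.
apply: (@cvgM R _ (nbhs u)); last exact: cvg_cst.
exact: coord_continuous.
Qed.

Lemma energy_normZ (m : nat) (A : 'M[R]_m) (a : R) (v : 'cV[R]_m) :
  energy_norm A (a *: v) = `|a| * energy_norm A v.
Proof.
rewrite /energy_norm -scalemxAr [(a *: v)^T]linearZ /= -!scalemxAl scalerA -expr2 mxE.
by rewrite sqrtrM ?sqr_ge0// sqrtr_sqr.
Qed.

Lemma energy_norm_mxP (m : nat) (A B : 'M[R]_m) :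
  (0 < m)%N -> pos_def A ->
  is_maximum
    [set energy_norm A (B *m v) / energy_norm A v | v in [set v | v != 0]]
    (energy_norm_mx A B).
Proof.
case: m A B => // m A B _ Apd.
apply: (xgetPex 0); pose K := [set u : 'rV[R]_m.+1 | `|u| = 1].
pose f (u : 'rV[R]_m.+1) := energy_norm A (B *m u^T) / energy_norm A u^T.
have K0 : K !=set0.
  have c0 : (const_mx 1 : 'rV[R]_m.+1) != 0.
    by apply/eqP => /matrixP/(_ 0 0); rewrite !mxE => /eqP; rewrite oner_eq0.
  exists (`|const_mx 1 : 'rV[R]_m.+1|^-1 *: const_mx 1) => /=.
  by rewrite /K /= normrZ normfV normr_id mulVf// normr_eq0.
have cK : compact K.
  apply: bounded_closed_compact.
    by exists 1; split => // M M1 u /= ->; exact: ltW.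
  apply: (@preimage_closed _ _ (fun u : 'rV[R]_m.+1 => `|u|) [set 1]).
    by move=> u _; exact: norm_continuous.
  exact: closed_eq.
have nz (u : 'rV[R]_m.+1) : K u -> u^T != 0.
  move=> u1; apply/eqP => /(congr1 trmx); rewrite trmxK trmx0 => u0.
  by move: u1; rewrite /K /= u0 normr0 => /eqP; rewrite eq_sym oner_eq0.
have cq (C : 'M[R]_m.+1) :
    continuous (fun u : 'rV[R]_m.+1 => Num.sqrt ((u *m C *m u^T) 0 0)).
  move=> u; apply: continuous_comp; first exact: quad_continuous.
  exact: sqrt_continuous.
have pos (v : 'cV[R]_m.+1) : v != 0 -> 0 < energy_norm A v.
  by move=> v0; rewrite /energy_norm sqrtr_gt0 Apd.
have fE : f = fun u => Num.sqrt ((u *m (B^T *m A *m B) *m u^T) 0 0) /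
                       Num.sqrt ((u *m A *m u^T) 0 0).
  apply/funext => u; rewrite /f /energy_norm trmxK trmx_mul trmxK.
  by rewrite !mulmxA.
have fc : {within K, continuous f}.
  apply: continuous_in_subspaceT => u; rewrite inE => /nz/pos uK.
  rewrite fE; apply: (@cvgM R _ (nbhs u)); first exact: cq.
  apply: (@cvgV R _ (nbhs u)); last exact: cq.
  by rewrite gt_eqF//; rewrite /energy_norm trmxK in uK.
have [c] := EVT_max_rV K0 cK fc; rewrite inE => cinK cmax.
exists (f c); split; first by exists c^T => //; exact: nz.
move=> _ [v v0 <-].
have vT0 : `|v^T| != 0 by rewrite normr_eq0 trmx_eq0.
have /cmax : `|v^T|^-1 *: v^T \in K.
  by rewrite inE /K /= normrZ normfV normr_id mulVf.
rewrite {1}/f linearZ /= trmxK -scalemxAr !energy_normZ.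
rewrite -mulf_div divff ?mul1r//.
by rewrite normr_eq0 invr_eq0.
Qed.

End EnergyNorm.

Section TwoLevel.
Variables (R : realType) (n ns nc : nat).
Variables (A : 'M[R]_n) (S : 'M[R]_(n, ns)) (P : 'M[R]_(n, nc)).
Variable Ms : 'M[R]_ns.

Definition smooth_mx : 'M[R]_ns := S^T *m A *m S.

Definition coarse_mx : 'M[R]_nc := P^T *m A *m P.

Definition coarse_proj : 'M[R]_n := P *m invmx coarse_mx *m P^T *m A.

Definition sym_smoother : 'M[R]_ns :=
  Ms^T *m invmx (Ms + Ms^T - smooth_mx) *m Ms.

Definition two_level_mx : 'M[R]_n :=
  (1%:M - S *m invmx Ms^T *m S^T *m A) *m (1%:M - coarse_proj)
  *m (1%:M - S *m invmx Ms *m S^T *m A).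

End TwoLevel.

(* Main.v *)
Require Import Defs.
From mathcomp Require Import all_boot all_order all_algebra.
From mathcomp Require Import ring lra zify.
From mathcomp Require Import all_classical all_reals all_analysis.

Set Implicit Arguments.
Unset Strict Implicit.
Unset Printing Implicit Defensive.

Import Order.TTheory GRing.Theory Num.Theory.
Local Open Scope ring_scope.

(** The iteration matrix is [E = G' Q G], where [G] and [G'] are the pre- and
    postsmoothing error propagators and [Q = 1 - coarse_proj A P] projects
    onto the [A]-orthogonal complement of the range of [P].  Since [G'] is the
    [A]-adjoint of [G] and [Q] is an [A]-self-adjoint idempotent, [A *m E] is
    symmetric positive semidefinite, so that the energy norm of [E] is its
    largest eigenvalue ([energy_norm_psd_spectral]).

    Write [Q = U V] with [V U = 1], of inner size [r = n - nc].  Swapping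
    factors preserves the nonzero part of the spectrum, hence
    [E = (G' U) (V G)] has the nonzero eigenvalues of
    [V G G' U = 1 - D], where [D = V S W S^T A U] and [W] is the inverse of the
    symmetrized smoother ([smoother_mulmx]).  The matrix
    [B = (W S^T A U) (V S)] in the right-hand side is obtained by the other
    grouping of the factors of [D].  By Sylvester's identity
    ([char_poly_mulmxC]) the spectrum of [B] is that of [D] completed with
    [ns - r] zeros, or more precisely [r + mult_0 B = ns + mult_0 D].

    Finally, [D] is self-adjoint positive definite for the inner product
    [U^T A U]: this is where [\rank (row_mx S P) = n] enters, as no nonzero
    vector is [A]-orthogonal to both ranges.  So 0 has multiplicity exactly
    [ns + nc - n] in the spectrum of [B], whose next entry is the smallest
    eigenvalue of [D], that is 1 minus the norm of [E].

    Only extremal eigenvalues are needed, and the existence of the largest one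
    comes from the attained maximum of the energy norm; no diagonalization of
    self-adjoint matrices is involved. *)

(** * Sorted lists and characteristic polynomials *)

(** The index of the first positive entry of a sorted nonnegative list is the
    number of its zeros: this turns the index in the theorem into a
    multiplicity. *)
Lemma nth_sorted_count0 (R : realDomainType) (mu : R) (s : seq R) :
  sorted <=%R s -> 0 < mu -> mu \in s ->
  (forall x, x \in s -> x = 0 \/ mu <= x) ->
  nth 0 s (count_mem 0 s) = mu.
Proof.
move=> + mu0; elim: s => // x s IH /= xs mus sP.
have sP' y : y \in s -> y = 0 \/ mu <= y.
  by move=> ys; apply: sP; rewrite inE ys orbT.
have xle y : y \in s -> x <= y by move/(order_path_min le_trans)/allP: xs; exact.
have [x0|mux] := sP x (mem_head _ _).
  rewrite x0 eqxx /=; apply: IH => //; first exact: path_sorted xs.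
  by move: mus; rewrite inE x0 gt_eqF.
have -> : x = mu.
  apply/le_anti; rewrite mux andbT.
  by move: mus; rewrite inE => /predU1P[->//|/xle].
have /count_memPn -> : 0 \notin s.
  by apply/negP => /xle; rewrite leNgt (lt_le_trans mu0 mux).
by rewrite gt_eqF.
Qed.

Lemma char_poly_trmx (R : comNzRingType) (n : nat) (B : 'M[R]_n) :
  char_poly B^T = char_poly B.
Proof.
rewrite /char_poly -[in RHS]det_tr /char_poly_mx.
by rewrite linearB /= tr_scalar_mx map_trmx.
Qed.

(** Column version of [eigenvalueP], whose eigenvectors are rows. *)
Lemma root_char_polyP (F : fieldType) (n : nat) (B : 'M[F]_n) (x : F) :
  reflect (exists2 v : 'cV_n, v != 0 & B *m v = x *: v) (root (char_poly B) x).
Proof.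
rewrite -char_poly_trmx -eigenvalue_root_char.
apply: (iffP eigenvalueP) => -[v Hv v0]; exists v^T; rewrite ?trmx_eq0//.
  by rewrite -[B]trmxK -trmx_mul Hv linearZ.
by rewrite -trmx_mul v0 linearZ.
Qed.

(** Sylvester's identity: both sides are the determinant of
    [block_mx 'X A B 1], reduced to triangular form by a multiplication on the
    right or on the left; the left multiplier has determinant ['X^m]. *)
Lemma char_poly_mulmxC (R : comNzRingType) (m n : nat)
    (A : 'M[R]_(n, m)) (B : 'M[R]_(m, n)) :
  'X^m * char_poly (A *m B) = 'X^n * char_poly (B *m A).
Proof.
pose a := map_mx polyC A; pose b := map_mx polyC B.
pose M := block_mx 'X%:M a b 1%:M.
have e1 : M *m block_mx 1%:M 0 (- b) 1%:M =
    block_mx (char_poly_mx (A *m B)) a 0 1%:M.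
  rewrite mulmx_block !mulmx1 !mulmx0 !mul1mx ?add0r ?subrr.
  by rewrite /char_poly_mx map_mxM mulmxN ?addr0 ?add0r.
have e2 : block_mx 1%:M 0 (- b) 'X%:M *m M =
    block_mx 'X%:M a 0 (char_poly_mx (B *m A)).
  rewrite mulmx_block !mul1mx !mul0mx !mulmx1 ?addr0.
  rewrite /char_poly_mx map_mxM mulNmx.
  by rewrite mul_mx_scalar mul_scalar_mx addNr mulNmx addrC.
have := congr1 determinant e1; have := congr1 determinant e2.
rewrite !det_mulmx !det_lblock !det_ublock !det1 !mul1r !mulr1 !det_scalar.
by move=> e3 e4; rewrite /char_poly -e4 e3.
Qed.

Lemma mupX (F : fieldType) (x : F) (k : nat) :
  mup x 'X^k = (k * (x == 0)%R)%N.
Proof.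
have := mup_XsubCX k x 0; rewrite subr0 => ->.
by rewrite eq_sym; case: eqP; rewrite ?muln1 ?muln0.
Qed.

(** Multiplicities of [A *m B] and [B *m A] agree away from 0, and at 0 they
    differ by the difference of the sizes. *)
Lemma mup_char_poly_mulmxC (F : fieldType) (m n : nat)
    (A : 'M[F]_(n, m)) (B : 'M[F]_(m, n)) (x : F) :
  (m * (x == 0)%R + mup x (char_poly (A *m B)) =
   n * (x == 0)%R + mup x (char_poly (B *m A)))%N.
Proof.
rewrite -!mupX -!mupM ?monic_neq0 ?monicXn ?char_poly_monic//.
by rewrite char_poly_mulmxC.
Qed.

Lemma mup_char_poly_gt0 (F : fieldType) (n : nat) (B : 'M[F]_n) (x : F) :
  (0 < mup x (char_poly B))%N = root (char_poly B) x.
Proof.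
by rewrite -XsubC_dvd ?dvdp_XsubCl ?monic_neq0 ?char_poly_monic.
Qed.

Lemma root_char_poly_mulmxC (F : fieldType) (m n : nat)
    (A : 'M[F]_(n, m)) (B : 'M[F]_(m, n)) (x : F) : x != 0 ->
  root (char_poly (A *m B)) x = root (char_poly (B *m A)) x.
Proof.
move=> x0; rewrite -!mup_char_poly_gt0.
by have := mup_char_poly_mulmxC A B x; rewrite (negPf x0) !muln0 !add0n => ->.
Qed.

(** * Quadratic forms and the energy norm *)

Section Forms.
Variable R : realType.
Implicit Type m : nat.

Definition pos_semidef m (C : 'M[R]_m) : Prop :=
  forall v : 'cV[R]_m, 0 <= (v^T *m C *m v) 0 0.

Lemma pos_def_semidef m (C : 'M[R]_m) : pos_def C -> pos_semidef C.
Proof.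
move=> Cpd v; have [->|/Cpd/ltW//] := eqVneq v 0.
by rewrite mulmx0 mxE.
Qed.

Lemma pos_def_inj m (C : 'M[R]_m) (v : 'cV[R]_m) :
  pos_def C -> C *m v = 0 -> v = 0.
Proof.
move=> Cpd Cv; apply/eqP; apply: contraT => /Cpd.
by rewrite -mulmxA Cv mulmx0 mxE ltxx.
Qed.

Lemma pos_def_unit m (C : 'M[R]_m) : pos_def C -> C \in unitmx.
Proof.
move=> Cpd; rewrite unitmxE unitfE; apply/negP => /det0P[v v0 vC].
have /Cpd : v^T != 0 by rewrite trmx_eq0.
by rewrite trmxK vC mul0mx mxE ltxx.
Qed.

Lemma mulmx_trl_eq0 m (v : 'cV[R]_m) : (v^T *m v) 0 0 = 0 -> v = 0.
Proof.
rewrite mxE => /eqP; rewrite psumr_eq0; last first.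
  by move=> i _; rewrite mxE -expr2 sqr_ge0.
move=> /allP h; apply/colP => i; rewrite !mxE.
by have := h i (mem_index_enum _); rewrite mxE /= -expr2 sqrf_eq0 => /eqP.
Qed.

Lemma mulmx_trl_ge0 m (v : 'cV[R]_m) : 0 <= (v^T *m v) 0 0.
Proof. by rewrite mxE sumr_ge0// => i _; rewrite mxE -expr2 sqr_ge0. Qed.

(** A vector where a nonnegative form vanishes minimizes it, so that the
    gradient [2 C v] of the form at that vector is 0. *)
Lemma pos_semidef_isotropic m (C : 'M[R]_m) (v : 'cV[R]_m) :
  C^T = C -> pos_semidef C -> (v^T *m C *m v) 0 0 = 0 -> C *m v = 0.
Proof.
move=> Csym Cpsd vCv; set u := C *m v.
apply: mulmx_trl_eq0; set a := (u^T *m u) 0 0.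
have a0 : 0 <= a by exact: mulmx_trl_ge0.
set b := (u^T *m C *m u) 0 0; have b0 : 0 <= b by exact: Cpsd.
have uT : u^T = v^T *m C by rewrite trmx_mul Csym.
have expand t : ((v + t *: u)^T *m C *m (v + t *: u)) 0 0 =
    t * a *+ 2 + t ^+ 2 * b.
  have -> : (v + t *: u)^T = v^T + t *: u^T by rewrite linearD linearZ.
  rewrite !(mulmxDl, mulmxDr) -!(scalemxAl, scalemxAr) -/u.
  have -> : v^T *m C *m u = u^T *m u by rewrite uT.
  have -> : u^T *m C *m v = u^T *m u by rewrite -mulmxA.
  have addE (X Y : 'M[R]_1) : (X + Y) 0 0 = X 0 0 + Y 0 0 by rewrite mxE.
  have scaleE k (X : 'M[R]_1) : (k *: X) 0 0 = k * X 0 0 by rewrite mxE.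
  by rewrite !(addE, scaleE) vCv -/a -/b; ring.
(* The parabola [2 a t + b t ^+ 2] is negative at [t = - a / (b + 1)] unless
   [a = 0]; the denominator [b + 1] avoids a case analysis on [b = 0]. *)
have /= := Cpsd (v + (- a / (b + 1)) *: u); rewrite expand => h.
apply/eqP; apply: contraT => aN0.
have apos : 0 < a by rewrite lt_neqAle eq_sym aN0.
have b1 : 0 < b + 1 by lra.
suff : (- a / (b + 1)) * a *+ 2 + (- a / (b + 1)) ^+ 2 * b < 0.
  by rewrite ltNge h.
have -> : - a / (b + 1) * a *+ 2 + (- a / (b + 1)) ^+ 2 * b =
   - (a ^+ 2 * (b + 2) / (b + 1) ^+ 2) by field; rewrite gt_eqF.
by rewrite oppr_lt0 divr_gt0 ?mulr_gt0 ?exprn_gt0//; lra.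
Qed.

(** A maximizer [v] of the Rayleigh quotient is an isotropic vector of the
    semidefinite form [c ^+ 2 *: A - E^T A E], which gives [E^2 v = c^2 v]; as
    [E] has no negative eigenvalue, [c] itself is an eigenvalue. *)
Lemma energy_norm_psd_spectral m (A E : 'M[R]_m) (c := energy_norm_mx A E) :
  (0 < m)%N -> spd A -> (A *m E)^T = A *m E -> pos_semidef (A *m E) ->
  [/\ 0 <= c, root (char_poly E) c &
      forall x, root (char_poly E) x -> `|x| <= c].
Proof.
move=> m0 [Asym Apd] Esym Epsd.
have [[v v0 vc] cmax] := energy_norm_mxP E m0 Apd.
have ubc w : w != 0 -> energy_norm A (E *m w) / energy_norm A w <= c.
  by move=> w0; apply: cmax; exists w.
have npos w : w != 0 -> 0 < energy_norm A w.
  by move=> w0; rewrite sqrtr_gt0 Apd.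
have c0 : 0 <= c by rewrite /c -vc divr_ge0 ?sqrtr_ge0.
have nsq w : energy_norm A w ^+ 2 = (w^T *m A *m w) 0 0.
  by rewrite sqr_sqrtr//; exact: pos_def_semidef.
pose C := c ^+ 2 *: A - E^T *m A *m E.
have formC w : (w^T *m C *m w) 0 0 =
    c ^+ 2 * energy_norm A w ^+ 2 - energy_norm A (E *m w) ^+ 2.
  have -> : w^T *m C *m w =
      c ^+ 2 *: (w^T *m A *m w) - (E *m w)^T *m A *m (E *m w).
    by rewrite /C mulmxBr mulmxBl -scalemxAr -scalemxAl trmx_mul !mulmxA.
  have subE (X Y : 'M[R]_1) k : (k *: X - Y) 0 0 = k * X 0 0 - Y 0 0.
    by rewrite !mxE.
  by rewrite subE !nsq.
have Csym : C^T = C.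
  by rewrite /C linearB linearZ /= !trmx_mul trmxK Asym mulmxA.
have Cpsd : pos_semidef C.
  move=> w; have [->|w0] := eqVneq w 0; first by rewrite mulmx0 mxE.
  rewrite formC subr_ge0 -exprMn lerXn2r ?nnegrE ?mulr_ge0 ?sqrtr_ge0//.
  by rewrite -ler_pdivrMr ?npos// ubc.
have Cv : C *m v = 0.
  apply: pos_semidef_isotropic => //.
  by rewrite formC -exprMn /c -vc divfK ?subrr// gt_eqF ?npos.
have EEv : E *m (E *m v) = c ^+ 2 *: v.
  apply/eqP; rewrite -subr_eq0 -oppr_eq0 opprB; apply/eqP.
  apply: (pos_def_inj Apd); rewrite -[RHS]Cv /C mulmxBr mulmxBl.
  rewrite -scalemxAr -scalemxAl !mulmxA; congr (_ - _ *m _ *m _).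
  by rewrite -Esym trmx_mul Asym.
split=> //.
(* [(E - c) (E + c) v = 0], so [(E + c) v] is an eigenvector for [c] unless it
   vanishes; in that case [- c] is an eigenvalue and positivity forces [c = 0]. *)
- pose w := E *m v + c *: v.
  have Ew : E *m w = c *: w.
    by rewrite /w mulmxDr EEv -scalemxAr scalerDr scalerA addrC.
  have [w0|w0] := eqVneq w 0; last by apply/root_char_polyP; exists w.
  have Ev : E *m v = - c *: v.
    by apply/eqP; rewrite -subr_eq0 scaleNr opprK; exact/eqP.
  apply/root_char_polyP; exists v => //.
  suff c_eq0 : c = 0 by rewrite Ev c_eq0 oppr0.
  have := Epsd v; rewrite -mulmxA -[A *m E *m v]mulmxA Ev -!scalemxAr mxE mulmxA.
  rewrite mulNr oppr_ge0 pmulr_lle0 ?Apd// => c_le0.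
  by apply/le_anti; rewrite c_le0.
- move=> x /root_char_polyP[w w0 Ew].
  by have := ubc w w0; rewrite Ew energy_normZ mulfK// gt_eqF ?npos.
Qed.
End Forms.

Lemma pos_def_congr (R : realType) (m n : nat) (C : 'M[R]_n) (L : 'M[R]_(n, m)) :
  pos_def C -> (forall v : 'cV_m, L *m v = 0 -> v = 0) ->
  pos_def (L^T *m C *m L).
Proof.
move=> Cpd Linj v v0.
have /Cpd : L *m v != 0 by apply: contra_neq v0; exact: Linj.
by rewrite trmx_mul !mulmxA.
Qed.

Lemma pos_semidef_congr (R : realType) (m n : nat) (C : 'M[R]_n)
    (L : 'M[R]_(n, m)) :
  pos_semidef C -> pos_semidef (L^T *m C *m L).
Proof. by move=> Cpsd v; have := Cpsd (L *m v); rewrite trmx_mul !mulmxA. Qed.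

Lemma energy_norm_mx_eq0 (R : realType) (m : nat) (A E : 'M[R]_m) :
  (0 < m)%N -> pos_def A -> energy_norm_mx A E = 0 -> E = 0.
Proof.
move=> m0 Apd c0; have [_] := energy_norm_mxP E m0 Apd; rewrite c0 => cmax.
suff E0 (v : 'cV_m) : E *m v = 0.
  apply/matrixP => i j; have /matrixP/(_ i 0) := E0 (delta_mx j 0).
  by rewrite -colE !mxE.
have [->|v0] := eqVneq v 0; first by rewrite mulmx0.
have vgt0 : 0 < energy_norm A v by rewrite sqrtr_gt0 Apd.
apply/eqP; apply: contraT => Ev0.
have : energy_norm A (E *m v) / energy_norm A v <= 0 by apply: cmax; exists v.
by rewrite pmulr_lle0 ?invr_gt0// leNgt sqrtr_gt0 Apd.
Qed.

(** * The complement of the coarse space *)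

(** With [Q = U V] the full-rank factorization, [U V U V = U V] and both factors
    can be cancelled. *)
Lemma idem_base_mulmx (F : fieldType) (n : nat) (Q : 'M[F]_n) :
  Q *m Q = Q -> row_base Q *m col_base Q = 1%:M.
Proof.
move=> QQ; apply: (row_full_inj (col_base_full Q)).
apply: (row_free_inj (row_base_free Q)) => /=.
by rewrite mulmx1 mulmxA mulmx_base -mulmxA mulmx_base.
Qed.

Section CoarseComplement.
Variables (R : realType) (n nc : nat) (A : 'M[R]_n) (P : 'M[R]_(n, nc)).
Hypotheses (A_spd : spd A) (rankP : \rank P = nc).

Let Q := 1%:M - coarse_proj A P.

Lemma coarse_mx_unit : coarse_mx A P \in unitmx.
Proof.
apply/pos_def_unit/pos_def_congr => [|v Pv]; first by case: A_spd.
have /row_fullP[B BP] : row_full P by rewrite /row_full rankP.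
by rewrite -[v]mul1mx -BP -mulmxA Pv mulmx0.
Qed.

Lemma coarse_compl_mulmx : Q *m P = 0.
Proof.
rewrite mulmxBl mul1mx -[coarse_proj _ _ *m P]mulmxA /coarse_proj.
rewrite -!mulmxA [P^T *m (A *m P)]mulmxA.
by rewrite mulVmx ?coarse_mx_unit// mulmx1 subrr.
Qed.

Lemma coarse_compl_adj : A *m Q = Q^T *m A.
Proof.
have [Asym _] := A_spd.
have Ac_sym : (coarse_mx A P)^T = coarse_mx A P.
  by rewrite /coarse_mx !trmx_mul trmxK Asym mulmxA.
rewrite mulmxBr linearB mulmxBl /= trmx1 mulmx1 mul1mx; congr (_ - _).
by rewrite /coarse_proj !trmx_mul trmxK Asym trmx_inv Ac_sym !mulmxA.
Qed.

Lemma coarse_compl_orth : P^T *m A *m Q = 0.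
Proof.
by rewrite -mulmxA coarse_compl_adj mulmxA -trmx_mul coarse_compl_mulmx trmx0
  mul0mx.
Qed.

Lemma coarse_compl_idem : Q *m Q = Q.
Proof.
rewrite {2}/Q mulmxBr mulmx1 /coarse_proj !mulmxA coarse_compl_mulmx.
by rewrite !mul0mx subr0.
Qed.

(** [Q P = 0] bounds the rank from above; [1 = Q + coarse_proj A P] bounds it
    from below. *)
Lemma rank_coarse_compl : \rank Q = (n - nc)%N.
Proof.
have Qle := mulmx0_rank_max coarse_compl_mulmx; rewrite rankP in Qle.
have : (\rank (Q + coarse_proj A P)%R <= \rank Q + \rank (coarse_proj A P))%N.
  exact: mxrank_add.
rewrite subrK mxrank1.
have : (\rank (coarse_proj A P) <= nc)%N.
  by rewrite /coarse_proj -!mulmxA mulmx_max_rank.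
lia.
Qed.

End CoarseComplement.

(** * The smoother *)

Section Smoother.
Variables (R : realType) (n ns : nat) (A : 'M[R]_n) (S : 'M[R]_(n, ns)).
Variable Ms : 'M[R]_ns.
Hypotheses (A_sym : A^T = A) (Ms_unit : Ms \in unitmx).
Hypothesis Ms_pd : pos_def (Ms + Ms^T - smooth_mx A S).

Lemma invmx_sym_smoother : invmx (sym_smoother A S Ms) =
  invmx Ms *m (Ms + Ms^T - smooth_mx A S) *m invmx Ms^T.
Proof.
have Ku := pos_def_unit Ms_pd; set K := Ms + _ - _ in Ku *.
have MTu : Ms^T \in unitmx by rewrite unitmx_tr.
have Su : sym_smoother A S Ms \in unitmx.
  by rewrite /sym_smoother !unitmx_mul MTu unitmx_inv Ku.
apply: (can_inj (mulKmx Su)); rewrite mulmxV// /sym_smoother -/K !mulmxA.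
by rewrite mulmxK// mulmxKV// mulmxV.
Qed.

Lemma invmx_sym_smoother_pd : pos_def (invmx (sym_smoother A S Ms)).
Proof.
rewrite invmx_sym_smoother -[invmx Ms]trmxK trmx_inv.
apply: pos_def_congr => // v Mv.
have MTu : Ms^T \in unitmx by rewrite unitmx_tr.
by rewrite -[v](mulKVmx MTu) Mv mulmx0.
Qed.

(** With [X] and [Y] the inverses of [Ms] and [Ms^T], both sides subtract
    [S (X + Y - X (smooth_mx A S) Y) S^T A] from the identity: a presmoothing and a
    postsmoothing step in a row amount to one step of the symmetrized
    smoother. *)
Lemma smoother_mulmx :
  (1%:M - S *m invmx Ms *m S^T *m A) *m (1%:M - S *m invmx Ms^T *m S^T *m A) =
  1%:M - S *m invmx (sym_smoother A S Ms) *m S^T *m A.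
Proof.
have MTu : Ms^T \in unitmx by rewrite unitmx_tr.
set X := invmx Ms; set Y := invmx Ms^T.
have -> : invmx (sym_smoother A S Ms) = Y + X - X *m smooth_mx A S *m Y.
  rewrite invmx_sym_smoother -/X -/Y mulmxBr mulmxDr mulVmx// mulmxBl mulmxDl.
  by rewrite mul1mx mulmxK.
rewrite mulmxBr mulmx1 mulmxBl mul1mx /smooth_mx.
rewrite mulmxBr mulmxDr !mulmxBl !mulmxDl !mulmxA.
by rewrite !opprD !opprK !addrA; congr (_ + _); rewrite addrAC.
Qed.

Lemma smoother_adj :
  A *m (1%:M - S *m invmx Ms^T *m S^T *m A) =
  (1%:M - S *m invmx Ms *m S^T *m A)^T *m A.
Proof.
rewrite mulmxBr linearB mulmxBl /= trmx1 mulmx1 mul1mx; congr (_ - _).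
by rewrite !trmx_mul trmxK A_sym trmx_inv !mulmxA.
Qed.

End Smoother.

(** * The convergence factor *)

Theorem theorem3p1 (R : realType) (n ns nc : nat)
    (A : 'M[R]_n) (S : 'M[R]_(n, ns)) (P : 'M[R]_(n, nc)) (Ms : 'M[R]_ns)
    (ns_le_n : (ns <= n)%N) (nc_lt_n : (nc < n)%N)
    (A_spd : spd A)
    (rankS : \rank S = ns) (rankP : \rank P = nc)
    (rankSP : \rank (row_mx S P) = n)
    (S_id : forall e : ns = n, castmx (erefl n, e) S = 1%:M)
    (Ms_unit : Ms \in unitmx)
    (Ms_pd : pos_def (Ms + Ms^T - smooth_mx A S)) :
  energy_norm_mx A (two_level_mx A S P Ms) =
  1 - eigval (invmx (sym_smoother A S Ms) *m S^T *m A
                *m (1%:M - coarse_proj A P) *m S)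
             (ns + nc - n + 1)%N.
Proof.
have [A_sym A_pd] := A_spd.
pose Q := 1%:M - coarse_proj A P.
have [r [U [V [r_eq UV VU]]]] : exists r (U : 'M[R]_(n, r)) (V : 'M[R]_(r, n)),
    [/\ r = (n - nc)%N, U *m V = Q & V *m U = 1%:M].
  exists (\rank Q), (col_base Q), (row_base Q); split.
  - exact: rank_coarse_compl.
  - exact: mulmx_base.
  - exact/idem_base_mulmx/coarse_compl_idem.
have AQ : A *m Q = Q^T *m A by exact: coarse_compl_adj.
have QU : Q *m U = U by rewrite -UV -mulmxA VU mulmx1.
have U_inj k (X : 'M[R]_(r, k)) : U *m X = 0 -> X = 0.
  by move=> UX; rewrite -[X]mul1mx -VU -mulmxA UX mulmx0.
pose W := invmx (sym_smoother A S Ms).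
have W_pd : pos_def W by exact: invmx_sym_smoother_pd.
pose G := 1%:M - S *m invmx Ms *m S^T *m A.
pose G' := 1%:M - S *m invmx Ms^T *m S^T *m A.
have GG' : G *m G' = 1%:M - S *m W *m S^T *m A by exact: smoother_mulmx.
have AG' : A *m G' = G^T *m A by exact: smoother_adj.
pose D := V *m S *m W *m S^T *m A *m U.
have D_compl : V *m (G *m G') *m U = 1%:M - D.
  by rewrite GG' mulmxBr mulmx1 mulmxBl VU /D !mulmxA.
have root_compl x : root (char_poly (1%:M - D)) (1 - x) = root (char_poly D) x.
  apply/root_char_polyP/root_char_polyP => -[v v0 Hv]; exists v => //.
    by move: Hv; rewrite mulmxBl mul1mx scalerBl scale1r => /addrI/oppr_inj.
  by rewrite mulmxBl mul1mx Hv scalerBl scale1r.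
(* [D] is self-adjoint positive definite for the inner product [U^T A U]. *)
have H_pd : pos_def (U^T *m A *m U) by apply: pos_def_congr => // v /U_inj.
have HD : U^T *m A *m U *m D =
    (S^T *m A *m U)^T *m W *m (S^T *m A *m U).
  have -> : U^T *m A *m U *m D =
      U^T *m (A *m Q) *m S *m W *m S^T *m A *m U by rewrite -UV /D !mulmxA.
  by rewrite AQ mulmxA -trmx_mul QU !trmx_mul A_sym trmxK !mulmxA.
(* [U v] is [A]-orthogonal to the range of [P], so if it is also
   [A]-orthogonal to the range of [S] it vanishes. *)
have SAU_inj (v : 'cV_r) : S^T *m A *m U *m v = 0 -> v = 0.
  move=> SAUv; apply: U_inj; apply: (pos_def_inj A_pd).
  have PAUv : P^T *m (A *m (U *m v)) = 0.
    by rewrite -QU !mulmxA coarse_compl_orth// !mul0mx.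
  have /row_freeP[B SPB] : row_free (row_mx S P) by rewrite /row_free rankSP.
  apply: trmx_inj; rewrite trmx0 -[LHS]mulmx1 -SPB [LHS]mulmxA mul_mx_row.
  have /(congr1 trmx) := PAUv; rewrite trmx_mul trmxK trmx0 => ->.
  have /(congr1 trmx) := SAUv.
  by rewrite -!mulmxA trmx_mul trmxK trmx0 => ->; rewrite row_mx0 mul0mx.
have HD_pd : pos_def (U^T *m A *m U *m D).
  by rewrite HD; apply: pos_def_congr.
have rootD_gt0 x : root (char_poly D) x -> 0 < x.
  move=> /root_char_polyP[v v0 Dv]; have := HD_pd v v0.
  rewrite mulmxA -mulmxA Dv -scalemxAr mxE pmulr_lgt0//.
  exact: H_pd.
pose E := two_level_mx A S P Ms.
have E_eq : E = G' *m Q *m G by [].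
have AE : A *m E = (Q *m G)^T *m A *m (Q *m G).
  have AQQ : Q^T *m A *m Q = A *m Q by rewrite -AQ -mulmxA coarse_compl_idem.
  transitivity (G^T *m (A *m Q) *m G); first by rewrite E_eq !mulmxA AG'.
  by rewrite -AQQ trmx_mul !mulmxA.
have A_psd := pos_def_semidef A_pd.
have AE_psd : pos_semidef (A *m E) by rewrite AE; exact: pos_semidef_congr.
have AE_sym : (A *m E)^T = A *m E by rewrite AE !trmx_mul !trmxK A_sym !mulmxA.
have n_gt0 : (0 < n)%N by apply: leq_trans nc_lt_n.
have [] := energy_norm_psd_spectral n_gt0 A_spd AE_sym AE_psd.
rewrite -/E; set c := energy_norm_mx A E => c_ge0 c_root c_max.
have rootE x : x != 0 -> root (char_poly E) x = root (char_poly (1%:M - D)) x.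
  have -> : E = (G' *m U) *m (V *m G) by rewrite E_eq -UV !mulmxA.
  by move=> x0; rewrite root_char_poly_mulmxC// -D_compl !mulmxA.
have rootD_min x : root (char_poly D) x -> 1 - c <= x.
  move=> Dx; have [->|x1] := eqVneq x 1; first by lra.
  have x1' : 1 - x != 0 by rewrite subr_eq0 eq_sym.
  have /c_max : root (char_poly E) (1 - x) by rewrite rootE// root_compl.
  by move=> /(le_trans (ler_norm _)); lra.
have rootD_c : root (char_poly D) (1 - c).
  rewrite -root_compl opprB addrCA subrr addr0.
  have [c0|c_neq0] := eqVneq c 0; last by rewrite -rootE.
  (* The nonzero-eigenvalue transfer says nothing about [c = 0].  In that case
     [E = 0], so [(1 - D)^2 = V G E G' U = 0], and a nilpotent matrix of positive
     size is singular. *)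
  have E0 : E = 0 by exact: energy_norm_mx_eq0 c0.
  have sq0 : (1%:M - D) *m (1%:M - D) = 0.
    have -> : (1%:M - D) *m (1%:M - D) = V *m G *m E *m G' *m U.
      by rewrite -D_compl E_eq -UV !mulmxA.
    by rewrite E0 mulmx0 !mul0mx.
  have u0 : (const_mx 1 : 'cV[R]_r) != 0.
    have r_gt0 : (0 < r)%N by rewrite r_eq subn_gt0.
    apply/eqP => /matrixP/(_ (Ordinal r_gt0) 0).
    by rewrite !mxE => /eqP; rewrite oner_eq0.
  rewrite c0; apply/root_char_polyP.
  have [z|nz] := eqVneq ((1%:M - D) *m (const_mx 1 : 'cV[R]_r)) 0.
    by exists (const_mx 1); rewrite // scale0r.
  by exists ((1%:M - D) *m const_mx 1); rewrite // scale0r mulmxA sq0 mul0mx.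
pose B := W *m S^T *m A *m Q *m S.
have mupB x : (r * (x == 0)%R + mup x (char_poly B) =
    ns * (x == 0)%R + mup x (char_poly D))%N.
  have -> : B = (W *m S^T *m A *m U) *m (V *m S) by rewrite /B -UV !mulmxA.
  by rewrite mup_char_poly_mulmxC /D !mulmxA.
have rootB x : x != 0 -> root (char_poly B) x = root (char_poly D) x.
  move=> x0; rewrite -!mup_char_poly_gt0.
  by have := mupB x; rewrite (negPf x0) !muln0 !add0n => ->.
have mem_spec x : (x \in real_spectrum B) = root (char_poly B) x.
  by rewrite -has_pred1 has_count count_real_spectrum mup_char_poly_gt0.
have c_gt0 := rootD_gt0 _ rootD_c.
have count0 : count_mem 0 (real_spectrum B) = (ns + nc - n)%N.
  have D0 : ~~ root (char_poly D) 0 by apply/negP => /rootD_gt0; rewrite ltxx.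
  have := mupB 0; rewrite count_real_spectrum (mupNroot D0) eqxx !muln1 addn0.
  by move: (mup _ _) => k; lia.
suff -> : eigval B (ns + nc - n + 1) = 1 - c by rewrite opprB addrCA subrr addr0.
rewrite /eigval addn1 -count0; apply: nth_sorted_count0 => //.
- exact: sorted_real_spectrum.
- by rewrite mem_spec rootB// gt_eqF.
- move=> x; rewrite mem_spec; have [->|x0] := eqVneq x 0; first by left.
  by rewrite rootB// => /rootD_min; right.
Qed.
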